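(* For all positive integers $m$ and $h$, there exist infinitely many positive integers $n$ with $s_2(n) = h$ such that the exponent of $2$ in the prime factorisation of $B(m, n)$ equals $s_2(m)s_2(n)$.
   Context: For positive integers $m$ and $n$, $B(m, n)$ denotes the number of balanced colourings of a $2m \times 2n$ rectangular grid, i.e., the number of ways to colour each cell black or white so that, in each row and each column, half of the cells are white and half are black. (An $a \times b$ grid has width $a$ and height $b$: each row consists of $a$ cells and each column of $b$ cells.) For a positive integer $x$, $s_2(x)$ denotes the number of $1$s in the binary expansion of $x$. *)

(* Defs.v *)
From mathcomp Require Import all_boot all_algebra.

Set Implicit Arguments.
Unset Strict Implicit.
Unset Printing Implicit Defensive.

(* An [a x b] grid has width [a] and height [b], so a colouring of the
   [2m x 2n] grid is a matrix with [2n] rows and [2m] columns; [true] stands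
   for black and [false] for white. *)
Definition colouring (m n : nat) := 'M[bool]_(2 * n, 2 * m).

Definition balanced (m n : nat) (C : colouring m n) : bool :=
  [forall c : bool,
     [forall i, #|[set j | C i j == c]| == m] &&
     [forall j, #|[set i | C i j == c]| == n]].

Definition B (m n : nat) : nat := #|[set C : colouring m n | balanced C]|.

(* [(x %/ 2 ^ i) %% 2] is the binary digit of [x] of weight [2 ^ i]; since
   [x < 2 ^ x], all digits with [x <= i] vanish. *)
Definition s2 (x : nat) : nat := \sum_(i < x) (x %/ 2 ^ i) %% 2.

(* Main.v *)
Require Import Defs.
From mathcomp Require Import all_boot all_fingroup all_algebra.
From mathcomp Require Import zify.
From mathcomp Require Import classical_sets cardinality.

Set Implicit Arguments.
Unset Strict Implicit.
Unset Printing Implicit Defensive.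

(** Write [W r k] for the number of [r]-row matrices of width [2 p] whose rows
    all have [p] black cells and whose column [j] has [k j] black cells, so that
    [B p n = W (2 n) n] with a constant column vector.  In other words [W r k] is
    the coefficient of [x^k] in the [r]-th power of the elementary symmetric
    polynomial of degree [p] in [2 p] variables.  Two facts carry the proof.

    - Cutting a grid horizontally makes [W (r + s)] the convolution of [W r] and
      [W s] ([grids_conv]).
    - Permuting rows gives [r %| k j * W r k] ([dvdn_grids]).  For [r = 2 ^ a] it
      says that [W r k] is divisible by [2 ^ (a - e)] as soon as some [k j] is
      not divisible by [2 ^ e.+1] ([dvdn_grids_pow2]).

    Adding a power of two to [n].  Cut a grid with [2 (n + 2 ^ b)] rows into [2 n]
    rows and [2 ^ b.+1] rows, where [n <= 2 ^ b].  If both parts are balanced the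
    contribution is [B p n * B p (2 ^ b)] ([B_split]).  Otherwise some column of
    the lower part has [2 ^ b + d] black cells with [0 < |d| <= n], and the
    divisibility above makes that contribution divisible by a power of two that
    grows with [b] while [n] stays fixed ([B_add_pow2]).  So once
    [logn 2 (B p (2 ^ b)) = s2 p] is known for all [b], adding ever larger powers
    of two to [n] realizes every digit sum infinitely often.

    The case of one binary digit.  By transposition the claim becomes
    [logn 2 (B (2 ^ a) m) = s2 m], which follows by adding the binary digits of
    [m] from the lowest to the highest ([logn_B_pow2]).  Here the new digit
    [2 ^ b] is not large compared with [m < 2 ^ b], and the bound on the
    unbalanced contributions has to be sharp.  The number of binary ones of [m]
    below position [e] bounds the valuation of [W (2 m) k] from below whenever
    [k] is congruent to [m] modulo [2 ^ e] (the property [digit_bound]), the lower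
    part makes up for the digits above position [e], and exchanging the colours
    pairs off the unbalanced contributions, which yields the last factor [2].
    The balanced contribution has the right valuation because
    [B (2 ^ a) (2 ^ b)] is [2] modulo [4]: one has [B p (2 ^ b) = 'C(2 p, p)]
    modulo [4] for every [b], and using this in both directions reduces to
    ['C(2, 1)]. *)

(** * Binary digits *)

Lemma s2E N x : x < 2 ^ N -> s2 x = \sum_(i < N) (x %/ 2 ^ i) %% 2.
Proof.
suff widen M K : x < 2 ^ M ->
    \sum_(i < M + K) (x %/ 2 ^ i) %% 2 = \sum_(i < M) (x %/ 2 ^ i) %% 2.
  move=> xN; have xx := ltn_expl x (ltnSn 1).
  by rewrite /s2 -(widen _ N xx) addnC widen.
move=> xM; rewrite big_split_ord /= [X in _ + X]big1 ?addn0 // => i _.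
by rewrite divn_small // (leq_trans xM) // leq_exp2l // leq_addr.
Qed.

Lemma s2_0 : s2 0 = 0.
Proof. by rewrite /s2 big_ord0. Qed.

Lemma digitD x y b i : i < b ->
  ((x + y * 2 ^ b) %/ 2 ^ i) %% 2 = (x %/ 2 ^ i) %% 2.
Proof.
move=> ib; rewrite -(subnK (ltnW ib)) expnD mulnA addnC divnMDl ?expn_gt0 //.
rewrite -modnDml -(prednK (_ : 0 < b - i)) ?subn_gt0 //.
by rewrite expnS mulnCA modnMr add0n.
Qed.

Lemma s2_add_pow2 x b : x < 2 ^ b -> s2 (x + 2 ^ b) = (s2 x).+1.
Proof.
move=> xb; rewrite (@s2E b.+1) ?(s2E xb) ?expnS; last by lia.
rewrite big_ord_recr /= divnDr // divn_small // divnn expn_gt0 /= add0n addn1.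
by congr _.+1; apply: eq_bigr => i _; rewrite -[2 ^ b]mul1n digitD.
Qed.

Lemma s2_mod_split x b e : x < 2 ^ b -> e <= b ->
  s2 x = s2 (x %% 2 ^ e) + \sum_(i < b - e) (x %/ 2 ^ (e + i)) %% 2.
Proof.
move=> xb eb; have xb' : x < 2 ^ (e + (b - e)) by rewrite subnKC.
rewrite (s2E xb') big_split_ord /=; congr (_ + _).
rewrite (@s2E e) ?ltn_pmod ?expn_gt0 //; apply: eq_bigr => i _.
by rewrite {1}(divn_eq x (2 ^ e)) addnC digitD.
Qed.

(** Each of the [b - e] digits that are cut off is at most [1]. *)
Lemma s2_mod_ge x b e :
  x < 2 ^ b -> e <= b -> s2 x <= s2 (x %% 2 ^ e) + (b - e).
Proof.
move=> xb eb; rewrite (s2_mod_split xb eb) leq_add2l.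
rewrite -[leqRHS]card_ord -sum1_card.
by apply: leq_sum => i _; rewrite -ltnS ltn_pmod.
Qed.

Lemma s2_mod_le x e : s2 (x %% 2 ^ e) <= s2 x.
Proof.
have xb : x < 2 ^ (x + e).
  by rewrite (leq_trans (ltn_expl x (ltnSn 1))) // leq_exp2l // leq_addr.
by rewrite (s2_mod_split xb (leq_addl _ _)) leq_addr.
Qed.

Lemma top_bit m : 0 < m -> exists m' b, m' < 2 ^ b /\ m = m' + 2 ^ b.
Proof.
move=> m0; have /andP[lo hi] := trunc_log_bounds (ltnSn 1) m0.
exists (m - 2 ^ trunc_log 2 m), (trunc_log 2 m).
by rewrite subnK // ltn_subLR // addnn -mul2n -expnS.
Qed.

(** * Divisibility and congruences *)

Lemma logn2_add e x y :
  0 < x -> logn 2 x = e -> 2 ^ e.+1 %| y -> logn 2 (x + y) = e.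
Proof.
move=> x0 xe ye; have xy0 : 0 < x + y by rewrite addn_gt0 x0.
apply/eqP; rewrite eqn_leq -ltnS ltnNge -!pfactor_dvdn //.
have ye' : 2 ^ e %| y by apply: dvdn_trans ye; rewrite dvdn_exp2l.
by rewrite (dvdn_addl _ ye) (dvdn_addl _ ye') !pfactor_dvdn // xe ltnn leqnn.
Qed.

(** An orbit [{x, f x}] contributes [2 * F x]; enumeration ranks select one
    element in each orbit. *)
Lemma sum_involution (T : finType) (P : pred T) (f : T -> T) (F : T -> nat) d :
    involutive f -> (forall x, P (f x) = P x) -> (forall x, P x -> f x != x) ->
    (forall x, P x -> F (f x) = F x) -> (forall x, P x -> d %| F x) ->
  d * 2 %| \sum_(x | P x) F x.
Proof.
move=> fK Pf fx Ff dF.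
pose lo x := enum_rank x < enum_rank (f x).
rewrite (bigID lo) /= [X in _ + X](_ : _ = \sum_(x | P x && lo x) F x).
  by rewrite addnn -muln2 dvdn_pmul2r // dvdn_sum // => x /andP[/dF].
rewrite (reindex_inj (inv_inj fK)) /=; apply: eq_big => [x|x /andP[]].
  rewrite Pf /lo fK; have [Px|//] /= := boolP (P x).
  rewrite -leqNgt leq_eqVlt (inj_eq val_inj) (inj_eq enum_rank_inj).
  by rewrite eq_sym (negPf (fx _ Px)).
by rewrite Pf => /Ff.
Qed.

Lemma eq_mod_close x y d : x = y %[mod d] -> x < y + d -> y < x + d -> x = y.
Proof.
have le u v : u = v %[mod d] -> v <= u -> u < v + d -> u = v.
  move=> /eqP uv vu lt; move: uv; rewrite eqn_mod_dvd //.
  have [|uv0] := posnP (u - v); first by lia.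
  by move/(dvdn_leq uv0); lia.
move=> xy xd yd; case: (leqP y x) => [|/ltnW] h; first exact: le.
by apply/esym/le.
Qed.

Lemma ndvdn_sub x y m d :
  x <= y -> y = m %[mod d] -> x <> m %[mod d] -> ~~ (d %| y - x).
Proof.
by move=> xy ym xm; rewrite -eqn_mod_dvd // ym; apply/eqP => /esym.
Qed.

(** The exponent [e] plays the role of the 2-adic valuation of the vector
    [c - m], without subtraction. *)
Lemma last_congruence (I : finType) (c : I -> nat) m i : c i != m ->
  exists e, (forall j, c j = m %[mod 2 ^ e]) /\
            exists j, c j <> m %[mod 2 ^ e.+1].
Proof.
move=> cm; pose P e := [exists j, c j != m %[mod 2 ^ e]].
have exP : exists e, P e.
  exists (c i + m); apply/existsP; exists i; apply: contra cm => /eqP cm.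
  have lt := ltn_expl (c i + m) (ltnSn 1).
  by apply/eqP; apply: eq_mod_close cm _ _; lia.
case: (ex_minnP exP) => -[|e] Pe emin.
  by case/existsP: Pe => j; rewrite !modn1.
exists e; split; last by case/existsP: Pe => j /eqP; exists j.
move=> j; apply/eqP; apply: contraLR (ltnSn e) => cj.
by rewrite -leqNgt; apply: emin; apply/existsP; exists j.
Qed.

(** * Grids with prescribed column sums *)

Lemma sum_mem (T : finType) (A : {set T}) : \sum_x (x \in A) = #|A|.
Proof.
by rewrite -sum1_card [RHS]big_mkcond; apply: eq_bigr => x _; case: ifP.
Qed.

Lemma sum_negb (I : finType) (F : pred I) : \sum_i ~~ F i = #|I| - \sum_i F i.
Proof.
apply/eqP; rewrite -(eqn_add2r (\sum_i F i)) subnK -?big_split /=.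
  by rewrite -sum1_card; apply/eqP/eq_bigr => i _; case: (F i).
by rewrite -sum1_card; apply: leq_sum => i _; apply: leq_b1.
Qed.

Definition grids (p q r : nat) (k : 'I_q -> nat) : {set 'M[bool]_(r, q)} :=
  [set C : 'M[bool]_(r, q) |
     [forall i, \sum_j C i j == p] && [forall j, \sum_i C i j == k j]].

Lemma gridsP p q r k (C : 'M[bool]_(r, q)) :
  reflect ((forall i, \sum_j C i j = p) /\ (forall j, \sum_i C i j = k j))
          (C \in grids p r k).
Proof.
by rewrite inE; apply: (iffP andP) => -[/'forall_eqP ? /'forall_eqP].
Qed.

Lemma eq_grids p q r (k1 k2 : 'I_q -> nat) :
  k1 =1 k2 -> grids p r k1 = grids p r k2.
Proof.
move=> k12; apply/setP=> C; rewrite !inE; congr (_ && _).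
by apply: eq_forallb => j; rewrite k12.
Qed.

Lemma sum_col_le r q (C : 'M[bool]_(r, q)) j : \sum_i C i j <= r.
Proof.
by rewrite -[leqRHS]card_ord -sum1_card; apply: leq_sum => i _; apply: leq_b1.
Qed.

Lemma grids_col_le p q r (k : 'I_q -> nat) j : 0 < #|grids p r k| -> k j <= r.
Proof. by case/card_gt0P => C /gridsP[_ <-]; apply: sum_col_le. Qed.

(** The product [k j * W] counts the pairs of a grid and a row that is black in
    column [j].  Row exchanges show that each of the [r] rows occurs equally often
    in these pairs. *)
Lemma dvdn_grids p q r (k : 'I_q -> nat) j : r %| k j * #|grids p r k|.
Proof.
have -> : k j * #|grids p r k| = \sum_i \sum_(C in grids p r k) C i j.
  rewrite exchange_big /= mulnC -sum_nat_const.
  by apply: eq_bigr => C /gridsP[_ ->].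
case: r => [|r]; first by rewrite big_ord0.
have row i :
    \sum_(C in grids p r.+1 k) C i j = \sum_(C in grids p r.+1 k) C ord0 j.
  have xrowK : involutive (@xrow bool r.+1 q i ord0).
    by move=> C; apply/matrixP => i' j'; rewrite !mxE tpermK.
  rewrite [RHS](reindex_inj (inv_inj xrowK)) /=.
  apply: eq_big => [C|C _]; last by rewrite !mxE tpermR.
  apply/gridsP/gridsP => -[Cr Cc]; split => [i'|j'].
  - by rewrite -(Cr (tperm i ord0 i')); apply: eq_bigr => j' _; rewrite mxE.
  - rewrite -(Cc j') [RHS](reindex_inj (@perm_inj _ (tperm i ord0))).
    by apply: eq_bigr => i' _; rewrite mxE.
  - rewrite -(Cr (tperm i ord0 i')); apply: eq_bigr => j' _.
    by rewrite mxE tpermK.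
  - rewrite -(Cc j') (reindex_inj (@perm_inj _ (tperm i ord0))).
    by apply: eq_bigr => i' _; rewrite mxE.
by under eq_bigr do rewrite row; rewrite sum_nat_const card_ord dvdn_mulr.
Qed.

Lemma dvdn_grids_pow2 p q a e (k : 'I_q -> nat) j :
  ~~ (2 ^ e.+1 %| k j) -> 2 ^ (a - e) %| #|grids p (2 ^ a) k|.
Proof.
move=> nke; have [->|W0] := posnP #|grids p (2 ^ a) k|; first exact: dvdn0.
have k0 : 0 < k j by case: (k j) nke => //; rewrite dvdn0.
have := dvdn_grids p (2 ^ a) k j; rewrite pfactor_dvdn ?muln_gt0 ?k0 // lognM //.
by rewrite !pfactor_dvdn // in nke *; lia.
Qed.

(** Cut the grid below row [r] and sort by the column sums [c] of the upper
    part; they are taken in ['I_r.+1] so as to range over a finite type. *)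
Lemma grids_conv p q r s (k : 'I_q -> nat) :
  #|grids p (r + s) k| =
  \sum_(c : {ffun 'I_q -> 'I_r.+1} | [forall j, c j <= k j])
     #|grids p r (fun j => c j)| * #|grids p s (fun j => k j - c j)|.
Proof.
pose top (C : 'M[bool]_(r + s, q)) : {ffun 'I_q -> 'I_r.+1} :=
  [ffun j => inord (\sum_i usubmx C i j)].
have topE C j : top C j = \sum_i usubmx C i j :> nat.
  by rewrite ffunE inordK // ltnS sum_col_le.
have colE (C : 'M[bool]_(r + s, q)) j :
    \sum_i C i j = top C j + \sum_i dsubmx C i j.
  rewrite topE big_split_ord /=.
  by congr (_ + _); apply: eq_bigr => i _; rewrite mxE.
rewrite -sum1_card.
rewrite (partition_big top
  (fun c : {ffun 'I_q -> 'I_r.+1} => [forall j, c j <= k j])) /=.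
  apply: eq_bigr => c /forallP ck.
  rewrite -cardsX -sum1_card.
  rewrite (reindex (fun D : 'M[bool]_(r, q) * 'M[bool]_(s, q) =>
                      col_mx D.1 D.2)) /=; last first.
    exists (fun C => (usubmx C, dsubmx C)) => [[D1 D2] _|C _] /=;
      last exact: vsubmxK.
    by rewrite col_mxKu col_mxKd.
  apply: eq_bigl => -[D1 D2]; rewrite !inE /=.
  have cE j : top (col_mx D1 D2) j = \sum_i D1 i j :> nat.
    by rewrite topE col_mxKu.
  apply/idP/idP.
    case/andP => /andP[/'forall_eqP Cr /'forall_eqP Cc] /eqP tc.
    apply/andP; split; apply/andP; split; apply/'forall_eqP => i.
    - by rewrite -(Cr (lshift s i)); apply: eq_bigr => j _; rewrite col_mxEu.
    - by rewrite -tc cE.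
    - by rewrite -(Cr (rshift r i)); apply: eq_bigr => j _; rewrite col_mxEd.
    - by rewrite -Cc colE col_mxKd tc addKn.
  case/andP => /andP[/'forall_eqP D1r /'forall_eqP D1c].
  case/andP => /'forall_eqP D2r /'forall_eqP D2c.
  have tc : top (col_mx D1 D2) = c.
    by apply/ffunP => j; apply: val_inj; rewrite /= cE D1c.
  rewrite tc eqxx andbT; apply/andP; split; apply/'forall_eqP => i.
    case: (split_ordP i) => i' ->; [rewrite -(D1r i')|rewrite -(D2r i')];
      apply: eq_bigr => j _.
      by rewrite col_mxEu.
    by rewrite col_mxEd.
  by rewrite colE col_mxKd tc D2c subnKC.
by move=> C /gridsP[_ Ck]; apply/forallP => j; rewrite -Ck colE leq_addr.
Qed.

(** Exchanging the colours preserves the row condition, since the width is twice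
    the number of black cells. *)
Lemma card_grids_compl p r (k : 'I_(2 * p) -> nat) : (forall j, k j <= r) ->
  #|grids p r (fun j => r - k j)| = #|grids p r k|.
Proof.
move=> kr; have negK : involutive (map_mx negb : 'M[bool]_(r, 2 * p) -> _).
  by move=> C; apply/matrixP => i j; rewrite !mxE negbK.
rewrite -!sum1_card [RHS](reindex_inj (inv_inj negK)) /=; apply: eq_bigl => C.
have rowE i : \sum_j (map_mx negb C) i j = 2 * p - \sum_j C i j.
  rewrite -[X in _ = X - _]card_ord -sum_negb.
  by apply: eq_bigr => j _; rewrite mxE.
have colE j : \sum_i (map_mx negb C) i j = r - \sum_i C i j.
  rewrite -[X in _ = X - _]card_ord -sum_negb.
  by apply: eq_bigr => i _; rewrite mxE.
have rowC i : \sum_j C i j <= 2 * p.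
  by rewrite -[leqRHS]card_ord -sum1_card; apply: leq_sum => j _; apply: leq_b1.
apply/gridsP/gridsP => -[Cr Cc]; split => i.
- by rewrite rowE Cr; lia.
- by rewrite colE Cc subKn.
- by have := Cr i; rewrite rowE; have := rowC i; lia.
- by have := Cc i; rewrite colE; have := sum_col_le C i; lia.
Qed.

(** * Balanced colourings as grids *)

Lemma B_grids m n : B m n = #|grids m (2 * n) (fun _ : 'I_(2 * m) => n)|.
Proof.
apply: eq_card => C; rewrite !inE.
have cnt (I : finType) (F : pred I) (c : bool) :
    #|[set x | F x == c]| = if c then \sum_x F x else #|I| - \sum_x F x.
  rewrite -sum_negb; case: c; rewrite -sum1dep_card big_mkcond /=;
  by apply: eq_bigr => x _; case: (F x).
apply/forallP/idP => [/(_ true)/andP[/'forall_eqP Cr /'forall_eqP Cc]|].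
  apply/andP; split; apply/'forall_eqP => i.
    by have := Cr i; rewrite cnt.
  by have := Cc i; rewrite cnt.
case/andP=> /'forall_eqP Cr /'forall_eqP Cc c.
apply/andP; split; apply/'forall_eqP => i; rewrite cnt ?Cr ?Cc card_ord;
case: c => //; lia.
Qed.

Lemma B_sym m n : B m n = B n m.
Proof.
rewrite -[LHS]sum1_card -[RHS]sum1_card.
rewrite (reindex (trmx : 'M[bool]_(2 * m, 2 * n) -> _)) /=; last first.
  by exists trmx => C _; rewrite trmxK.
apply: eq_bigl => C; rewrite !inE; apply: eq_forallb => c; rewrite andbC.
congr (_ && _); apply: eq_forallb => i; congr (#|pred_of_set _| == _);
by apply/setP => j; rewrite !inE mxE.
Qed.

Lemma B_m0 p : B p 0 = 1.
Proof.
rewrite B_grids; apply/eqP/cards1P; exists (\matrix_(i, j) false)%R.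
apply/setP => C; rewrite finset.in_set1; apply/idP/eqP => _.
  by apply/matrixP => -[].
by apply/gridsP; split=> [[]//|j]; rewrite big1 // => -[].
Qed.

(** * Residues modulo 4 *)

(** Column sums of the grid of height [r] all of whose rows equal [S]. *)
Definition full q r (S : {set 'I_q}) : {ffun 'I_q -> 'I_r.+1} :=
  [ffun j => if j \in S then ord_max else ord0].

Lemma grids_fullP p q r (S : {set 'I_q}) (C : 'M[bool]_(r, q)) :
  C \in grids p r (fun j => full r S j) -> C = (\matrix_(i, j) (j \in S))%R.
Proof.
case/gridsP => _ Cc; apply/matrixP => i j; rewrite mxE; have := Cc j.
rewrite ffunE; case: ifP => _ /= Cj.
  have /eqP := sum_negb (C^~ j); rewrite card_ord Cj subnn sum_nat_eq0.
  by move=> /forallP /(_ i) /=; case: (C i j).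
by move/eqP: Cj; rewrite sum_nat_eq0 => /forallP /(_ i) /=; case: (C i j).
Qed.

Lemma card_grids_full p q r (S : {set 'I_q}) :
  #|S| = p -> #|grids p r (fun j => full r S j)| = 1.
Proof.
move=> Sp; apply/eqP/cards1P; exists (\matrix_(i, j) (j \in S))%R.
apply/setP=> C; rewrite finset.in_set1; apply/idP/eqP => [/grids_fullP //|->].
apply/gridsP; split=> [i|j].
  by under eq_bigr do rewrite mxE; rewrite sum_mem.
under eq_bigr do rewrite mxE.
by rewrite sum_nat_const card_ord ffunE; case: ifP; rewrite ?muln1 ?muln0.
Qed.

Lemma full_inj q r : 0 < r -> injective (@full q r).
Proof.
move=> r0 S1 S2 /ffunP E; apply/setP => j; have := E j; rewrite !ffunE.
by case: ifP; case: ifP => // _ _ /(congr1 val) /=; lia.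
Qed.

(** By [dvdn_grids], an odd count forces every column sum to be divisible by
    [2 ^ b], that is, to be [0] or [2 ^ b]. *)
Lemma odd_gridsP p q b (c : {ffun 'I_q -> 'I_(2 ^ b).+1}) :
  odd #|grids p (2 ^ b) (fun j => c j)| ->
  exists2 S : {set 'I_q}, #|S| = p & c = full (2 ^ b) S.
Proof.
move=> oddW; have W0 := odd_gt0 oddW.
have cE : c = full (2 ^ b) [set j | (c j : nat) == 2 ^ b].
  apply/ffunP => j; apply: val_inj; rewrite ffunE inE.
  case: eqP => //= cj; have := dvdn_grids p (2 ^ b) (fun j => c j) j.
  rewrite Gauss_dvdl ?coprimeXl ?coprime2n // => dv.
  have := ltn_ord (c j); case: (posnP (c j)) => // c0.
  by have := dvdn_leq c0 dv; lia.
set S := [set j | _] in cE; exists S => //.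
rewrite cE in W0; case/card_gt0P: W0 => C CW; move/grids_fullP: (CW) => CE.
case/gridsP: CW => /(_ (Ordinal (expn_gt0 2 b : 0 < 2 ^ b))) <- _.
by rewrite CE; under [RHS]eq_bigr do rewrite mxE; rewrite sum_mem.
Qed.

(** Squares of even numbers vanish modulo [4], so only the vectors [full S] with
    [#|S| = p] matter, and each of these is the column sum vector of one grid. *)
Lemma sum_grids_sq_mod4 p q b :
  \sum_(c : {ffun 'I_q -> 'I_(2 ^ b).+1}) #|grids p (2 ^ b) (fun j => c j)| ^ 2
  = 'C(q, p) %[mod 4].
Proof.
pose D := [set S : {set 'I_q} | #|S| == p].
rewrite (bigID (mem (full (2 ^ b) @: D))) /=; set rest := (X in _ + X).
have /eqP rest0 : 4 %| rest.
  apply: dvdn_sum => c cD; rewrite -[4]/(2 ^ 2) dvdn_exp2r // dvdn2.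
  apply: contra cD => /odd_gridsP [S Sp ->]; apply: imset_f.
  by rewrite inE Sp.
rewrite -modnDmr rest0 addn0 big_imset /=; last first.
  by move=> S1 S2 _ _; apply: full_inj; rewrite expn_gt0.
rewrite (eq_bigr (fun _ => 1)); last first.
  by move=> S; rewrite inE => /eqP /card_grids_full ->.
by rewrite sum1_card card_draws card_ord.
Qed.

(** Cut the grid in half: the two halves have complementary column sums, hence
    equally many grids, and [B] is a sum of squares. *)
Lemma B_pow2_mod4 p b : B p (2 ^ b) = 'C(2 * p, p) %[mod 4].
Proof.
rewrite B_grids [2 * 2 ^ b]mul2n -addnn grids_conv.
rewrite -(sum_grids_sq_mod4 p (2 * p) b).
congr (_ %% 4); apply: eq_big => [c|c _].
  by apply/forallP => j; rewrite -ltnS.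
rewrite (@card_grids_compl _ _ (fun j => c j)) // => j; by rewrite -ltnS.
Qed.

(** The residue [B p (2 ^ b)] modulo [4] is independent of [b], so the exponents
    [b] and [a] can be brought to [0] in turn. *)
Lemma B_pow2_pow2_mod4 a b : B (2 ^ a) (2 ^ b) = 2 %[mod 4].
Proof.
by rewrite B_pow2_mod4 -(B_pow2_mod4 _ 0) B_sym B_pow2_mod4.
Qed.

Lemma logn_B_pow2_pow2 a b :
  0 < B (2 ^ a) (2 ^ b) /\ logn 2 (B (2 ^ a) (2 ^ b)) = 1.
Proof.
have := B_pow2_pow2_mod4 a b; set x := B _ _ => xE.
have x0 : 0 < x by case: x xE.
split=> //; rewrite (divn_eq x 4) xE addnC.
by apply: logn2_add => //; rewrite dvdn_mull.
Qed.

(** * Splitting off a power of two *)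

Definition center q m : {ffun 'I_q -> 'I_(2 * m).+1} := [ffun=> inord m].

Lemma centerE q m j : center q m j = m :> nat.
Proof. by rewrite ffunE inordK // ltnS mul2n -addnn leq_addr. Qed.

Lemma neq_centerP q m (c : {ffun 'I_q -> 'I_(2 * m).+1}) :
  c != center q m -> exists j : 'I_q, (c j : nat) != m.
Proof.
move=> cm; apply/existsP; apply: contraR cm; rewrite negb_exists => /forallP cE.
apply/eqP/ffunP => j; apply: val_inj; have := cE j.
by rewrite negbK /= centerE => /eqP.
Qed.

(** The term of [grids_conv] at [center] is the one where both parts are
    balanced. *)
Lemma B_split p m b : m <= 2 ^ b ->
  B p (m + 2 ^ b) = B p m * B p (2 ^ b) +
  \sum_(c : {ffun 'I_(2 * p) -> 'I_(2 * m).+1} | c != center _ m)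
    #|grids p (2 * m) (fun j => c j)| *
    #|grids p (2 ^ b.+1) (fun j => m + 2 ^ b - c j)|.
Proof.
move=> mb; rewrite B_grids mulnDr -expnS grids_conv.
have ck (c : {ffun 'I_(2 * p) -> 'I_(2 * m).+1}) : [forall j, c j <= m + 2 ^ b].
  by apply/forallP => j; have := ltn_ord (c j); lia.
rewrite (bigD1 (center _ m)) //= !B_grids; congr (_ * _ + _).
- by congr #|pred_of_set _|; apply: eq_grids => j; rewrite centerE.
- rewrite -expnS; congr #|pred_of_set _|.
  by apply: eq_grids => j; rewrite centerE addKn.
- by apply: eq_bigl => c; rewrite ck.
Qed.

(** * The valuation of B (2 ^ a) m *)

(** The lower bound for the valuation that survives adding binary digits.  Taking
    [e] large makes it a bound by [s2 m] at the constant vector [m] alone, and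
    smaller exponents [e] say how fast it degrades away from that vector. *)
Definition digit_bound p q m := forall e (k : 'I_q -> nat),
  (forall j, k j = m %[mod 2 ^ e]) ->
  2 ^ s2 (m %% 2 ^ e) %| #|grids p (2 * m) k|.

(** The digits of [m] in positions [e] to [b - 1], which the bound for the upper
    part misses, number at most [b - e], and the lower part contributes one factor
    [2] more than that. *)
Lemma dvdn_grids_term p q m b e (c k : 'I_q -> nat) j :
    m < 2 ^ b -> e <= b ->
    2 ^ s2 (m %% 2 ^ e) %| #|grids p (2 * m) c| ->
    ~~ (2 ^ e.+1 %| k j) ->
  2 ^ (s2 m).+1 %| #|grids p (2 * m) c| * #|grids p (2 ^ b.+1) k|.
Proof.
move=> mb eb dm /(dvdn_grids_pow2 p b.+1) dk.
apply: dvdn_trans (dvdn_mul dm dk); rewrite -expnD dvdn_exp2l //.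
by have := s2_mod_ge mb eb; lia.
Qed.

(** Both the balanced term and each unbalanced term of [B_split] are divisible by
    [2 ^ (s2 m).+1]; the unbalanced ones come in pairs of equal terms, so that
    only the balanced one counts. *)
Lemma logn_B_add_digit p m b :
    m < 2 ^ b -> digit_bound p (2 * p) m ->
    0 < B p m -> logn 2 (B p m) = s2 m ->
    0 < B p (2 ^ b) -> logn 2 (B p (2 ^ b)) = 1 ->
  0 < B p (m + 2 ^ b) /\ logn 2 (B p (m + 2 ^ b)) = (s2 m).+1.
Proof.
move=> mb dm B0 logB Bp0 logBp; rewrite (B_split _ (ltnW mb)).
split; first by rewrite addn_gt0 muln_gt0 B0 Bp0.
apply: logn2_add; rewrite ?muln_gt0 ?B0 // ?lognM // ?logB ?logBp ?addn1 //.
pose rev (c : {ffun 'I_(2 * p) -> 'I_(2 * m).+1}) := [ffun j => rev_ord (c j)].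
have revE c j : rev c j = 2 * m - c j :> nat by rewrite ffunE /= subSS.
have revK : involutive rev.
  by move=> c; apply/ffunP => j; rewrite !ffunE rev_ordK.
have rev_center : rev (center _ m) = center _ m.
  by apply/ffunP => j; apply: ord_inj; rewrite revE !centerE; lia.
rewrite [in X in X %| _]expnSr.
apply: (@sum_involution _ _ rev) => [//|c|c cm|c _|c cm].
- by rewrite -{1}rev_center (inj_eq (inv_inj revK)).
- have [j cj] := neq_centerP cm; apply: contra cj => /eqP revc.
  by have := revE c j; rewrite revc; case: (c j) => x /= _; lia.
- congr (_ * _).
    rewrite -[RHS]card_grids_compl; last by move=> j; rewrite -ltnS.
    by congr #|pred_of_set _|; apply: eq_grids => j; rewrite revE.
  have cle j : c j <= 2 * m by rewrite -ltnS.
  have kle j : m + 2 ^ b - c j <= 2 ^ b.+1 by rewrite expnS; lia.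
  rewrite -[RHS]card_grids_compl //.
  congr #|pred_of_set _|; apply: eq_grids => j.
  by rewrite revE expnS; case: (c j) (cle j) => x /= _; lia.
- have [i ci] := neq_centerP cm.
  have [e [ce [j cj]]] := @last_congruence _ (fun j => c j) _ _ ci.
  have eb : e < b.
    rewrite ltnNge; apply/negP => be; move/eqP: ci; apply.
    have be' : 2 ^ b <= 2 ^ e by rewrite leq_exp2l.
    by apply: (@eq_mod_close _ _ (2 ^ e)); [exact: ce| |];
      case: (c i) => x /=; lia.
  apply: (dvdn_grids_term mb (ltnW eb) (dm e _ ce) (j := j)).
  apply: ndvdn_sub cj; first by case: (c j) => x /=; lia.
  by rewrite -(subnK eb) expnD -modnDmr modnMl addn0.
Qed.

(** For [e <= b] the bound only involves the digits of [m], and it is inherited by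
    every term of the convolution: from the upper part if its column sums are
    congruent to [m] modulo [2 ^ e], from [dvdn_grids_term] otherwise.  For [e > b]
    the constant vector is the only one with a nonzero count. *)
Lemma digit_bound_add_digit p m b :
    m < 2 ^ b -> digit_bound p (2 * p) m ->
    2 ^ s2 (m + 2 ^ b) %| B p (m + 2 ^ b) ->
  digit_bound p (2 * p) (m + 2 ^ b).
Proof.
move=> mb dm dB e k km.
have [->|W0] := posnP #|grids p (2 * (m + 2 ^ b)) k|; first exact: dvdn0.
have [eb|be] := leqP e b; last first.
  have mlte : m + 2 ^ b < 2 ^ e.
    by apply: (@leq_trans (2 ^ b.+1)); rewrite ?leq_exp2l // expnS; lia.
  suff -> : #|grids p (2 * (m + 2 ^ b)) k| = B p (m + 2 ^ b).
    by rewrite modn_small.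
  rewrite B_grids; congr #|pred_of_set _|; apply: eq_grids => j.
  by apply: eq_mod_close (km j) _ _; have := grids_col_le j W0; lia.
have modm f : f <= b -> m + 2 ^ b = m %[mod 2 ^ f].
  by move=> fb; rewrite -(subnK fb) expnD -modnDmr modnMl addn0.
rewrite modm // mulnDr -expnS grids_conv; apply: dvdn_sum => c /forallP ck.
have [/'forall_eqP ce|] := boolP [forall j, c j %% 2 ^ e == m %% 2 ^ e].
  by rewrite dvdn_mulr // dm.
case/forallPn => i ci.
have ci' : (c i : nat) != m by apply: contra ci => /eqP ->.
have [f [cf [j cj]]] := @last_congruence _ (fun j => c j) _ _ ci'.
have fe : f < e.
  rewrite ltnNge; apply/negP => ef; case/eqP: ci.
  by rewrite -(modn_dvdm (c i) (dvdn_exp2l 2 ef)) cf modn_dvdm // dvdn_exp2l.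
apply: (@dvdn_trans (2 ^ (s2 m).+1)).
  by rewrite dvdn_exp2l // leqW // s2_mod_le.
apply: (dvdn_grids_term mb (leq_trans (ltnW fe) eb) (dm f _ cf) (j := j)).
apply: (ndvdn_sub (m := m)) => //.
rewrite -(modn_dvdm (k j) (dvdn_exp2l 2 fe)) km modn_dvdm ?dvdn_exp2l // modm //.
exact: leq_trans fe eb.
Qed.

Lemma logn_B_pow2 a m :
  0 < B (2 ^ a) m /\ logn 2 (B (2 ^ a) m) = s2 m.
Proof.
suff [] : [/\ digit_bound (2 ^ a) (2 * 2 ^ a) m,
              0 < B (2 ^ a) m & logn 2 (B (2 ^ a) m) = s2 m] by [].
elim/ltn_ind: m => m IH; have [->|m0] := posnP m.
  by rewrite B_m0 s2_0; split=> // e k _; rewrite mod0n s2_0 dvd1n.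
have [m' [b [mb mE]]] := top_bit m0.
have mlt : m' < m by rewrite mE -addn1 leq_add2l expn_gt0.
have [dm' B0 logB] := IH _ mlt; have [Bp0 logBp] := logn_B_pow2_pow2 a b.
have [Bm0 logBm] := logn_B_add_digit mb dm' B0 logB Bp0 logBp.
rewrite mE s2_add_pow2 //; split=> //; apply: digit_bound_add_digit => //.
by rewrite s2_add_pow2 // pfactor_dvdn // logBm.
Qed.

(** * Adding large powers of two *)

(** An unbalanced term has a column whose lower part has [2 ^ (n + t) + d] black
    cells with [0 < |d| <= n < 2 ^ n], hence a number not divisible by [2 ^ n]. *)
Lemma B_add_pow2 m n t : exists r,
  B m (n + 2 ^ (n + t)) = B m n * B m (2 ^ (n + t)) + 2 ^ t.+1 * r.
Proof.
have nlt := ltn_expl n (ltnSn 1).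
have nb : n <= 2 ^ (n + t).
  by rewrite (leq_trans (ltnW nlt)) // leq_exp2l // leq_addr.
rewrite B_split //; set S := \sum_(c | _) _.
suff /dvdnP[r ->] : 2 ^ t.+1 %| S by exists r; rewrite [r * _]mulnC.
apply: dvdn_sum => c /neq_centerP [j cj]; apply: dvdn_mull.
have clt := ltn_ord (c j).
have n0 : 0 < n by case: (c j) cj clt => x /=; lia.
have := @dvdn_grids_pow2 m _ (n + t).+1 n.-1 (fun j => n + 2 ^ (n + t) - c j) j.
rewrite prednK // (_ : (n + t).+1 - n.-1 = t.+2); last by lia.
move=> H; apply: dvdn_trans (H _); first by rewrite dvdn_exp2l.
apply: (ndvdn_sub (m := n)); first by lia.
  by rewrite expnD -modnDmr modnMr addn0.
by move=> cn; move/eqP: cj; apply; apply: eq_mod_close cn _ _; lia.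
Qed.

Lemma logn_B_add_pow2 m n h N :
    s2 n = h -> 0 < B m n -> logn 2 (B m n) = s2 m * h ->
  exists n', [/\ N <= n', s2 n' = h.+1, 0 < B m n'
               & logn 2 (B m n') = s2 m * h.+1].
Proof.
(* The error term of [B_add_pow2] must not reach the valuation [s2 m * h.+1]. *)
move=> nh B0 logB; pose t := s2 m * h.+1 + N; exists (n + 2 ^ (n + t)).
have [r Br] := B_add_pow2 m n t.
have [B1 logB1] := logn_B_pow2 (n + t) m; rewrite B_sym in B1 logB1.
have lt := ltn_expl (n + t) (ltnSn 1).
have BB0 : 0 < B m n * B m (2 ^ (n + t)) by rewrite muln_gt0 B0.
split.
- by rewrite /t in lt *; lia.
- by rewrite s2_add_pow2 ?nh //; lia.
- by rewrite Br addn_gt0 BB0.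
rewrite Br; apply: logn2_add => //.
  by rewrite lognM // logB logB1 mulnS addnC.
by rewrite dvdn_mulr // dvdn_exp2l // ltnS leq_addr.
Qed.

(** The induction starts at [n = 0], where [B m 0 = 1] has digit sum and valuation
    zero. *)
Lemma exists_logn_B m h N :
  exists n, [/\ N <= n, s2 n = h.+1, 0 < B m n & logn 2 (B m n) = s2 m * h.+1].
Proof.
elim: h N => [|h IH] N.
  by apply: (@logn_B_add_pow2 m 0 0 N s2_0); rewrite B_m0 ?logn1 ?muln0.
by have [n [_ nh B0 logB]] := IH 0; apply: logn_B_add_pow2 B0 logB.
Qed.

Local Open Scope classical_set_scope.

Theorem proposition1 (m h : nat) (m_gt0 : 0 < m) (h_gt0 : 0 < h) :
  infinite_set
    [set n : nat | [/\ 0 < n, s2 n = h & logn 2 (B m n) = s2 m * s2 n]].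
Proof.
case: h h_gt0 => // h _ /finite_seqP [s sE].
have [n [sn nh B0 logB]] := exists_logn_B m h (\max_(x <- s) x).+1.
have : [set` s] n.
  by rewrite -sE /= nh; split=> //; apply: leq_ltn_trans sn.
move=> /= ns; have := @leq_bigmax_seq _ s xpredT id n ns isT.
by rewrite leqNgt sn.
Qed.
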